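(* Let $d\ge 1$ be an integer, let $\sigma>0$, and let $R_N(u)=\frac{\sigma}{4}\int_{\mathbb{T}^d} :\! u_N^4\!:\,dx$ (the renormalized quartic potential energy described in the context). Then, for any $K>0$, \[ \sup_{N\in\mathbb{N}}\mathbb{E}_\mu\big[e^{R_N(u)}\big]\ \ge\ \sup_{N\in\mathbb{N}}\mathbb{E}_\mu\Big[\mathbf 1_{\{\int_{\mathbb{T}^d}:u_N^2:\,dx\le K\}}e^{R_N(u)}\Big]\ \ge\ \sup_{N\in\mathbb{N}}\mathbb{E}_\mu\Big[\mathbf 1_{\{|\int_{\mathbb{T}^d}:u_N^2:\,dx|\le K\}}e^{R_N(u)}\Big]=\infty . \] In particular, the focusing quartic Gibbs measure $Z^{-1}e^{R(u)}d\mu$, even with a Wick-ordered $L^2$-cutoff, cannot be defined as a probability measure.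
   Context: $\mathbb{T}^d=(\mathbb{R}/2\pi\mathbb{Z})^d$ is equipped with the normalized Lebesgue measure $dx=(2\pi)^{-d}dx_{\mathrm{Leb}}$; $e_n(x)=e^{in\cdot x}$, $\langle n\rangle=(1+|n|^2)^{1/2}$. The log-correlated Gaussian field $\mu$ is the law of the random distribution $u=\sum_{n\in\mathbb{Z}^d}\langle n\rangle^{-d/2}g_n e_n$, where $\{g_n\}_{n\in\mathbb{Z}^d}$ are independent standard complex Gaussian random variables conditioned on $g_{-n}=\overline{g_n}$ (so $g_0$ is a standard real Gaussian); formally $d\mu=Z^{-1}e^{-\frac12\|u\|_{H^{d/2}}^2}du$. For $N\in\mathbb{N}$, $\pi_N f=\sum_{|n|\le N}\widehat f(n)e_n$ and $u_N=\pi_N u$. Set $\sigma_N=\mathbb{E}[u_N(x)^2]=\sum_{|n|\le N}\langle n\rangle^{-d}$ (independent of $x$). Wick powers are $:\!u_N^k\!:\,=H_k(u_N;\sigma_N)$, where $H_k(x;s)$ are the Hermite polynomials with variance parameter $s$, defined by $e^{tx-\frac12 s t^2}=\sum_{k\ge0}\frac{t^k}{k!}H_k(x;s)$; in particular $:\!u_N^2\!:\,=u_N^2-\sigma_N$ and $:\!u_N^4\!:\,=u_N^4-6\sigma_N u_N^2+3\sigma_N^2$. *)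

(* Defs.v *)
From HB Require Import structures.
From mathcomp Require Import all_boot all_order all_algebra.
From mathcomp Require Import all_classical all_reals all_analysis.
Set Implicit Arguments. Unset Strict Implicit. Unset Printing Implicit Defensive.
Import Order.TTheory GRing.Theory Num.Theory.
Local Open Scope classical_set_scope.
Local Open Scope ring_scope.

Section Defs.
Variable R : realType.

Definition lattice (d : nat) := {ffun 'I_d -> int}.

Definition lneg d (n : lattice d) : lattice d := [ffun i => - n i].

Definition lnorm2 d (n : lattice d) : R := \sum_(i < d) ((n i)%:~R) ^+ 2.

Definition jbr d (n : lattice d) : R := Num.sqrt (1 + lnorm2 n).

Definition ldot d (n : lattice d) (x : nat -> R) : R :=
  \sum_(i < d) (n i)%:~R * x (val i).

(* The box {-N..N}^d enumerated by {ffun 'I_d -> 'I_(2N+1)} via k |-> k - N. *)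
Definition boxpt d N (k : {ffun 'I_d -> 'I_(N.*2.+1)}) : lattice d :=
  [ffun i => (k i)%:Z - N%:Z].

Definition sum_ball d N (F : lattice d -> R) : R :=
  \sum_(k : {ffun 'I_d -> 'I_(N.*2.+1)} | lnorm2 (boxpt k) <= (N%:R) ^+ 2)
     F (boxpt k).

Definition sigmaN d N : R := sum_ball (d:=d) N (fun n => (jbr n ^+ d)^-1).

Definition hermite2 (x s : R) : R := x ^+ 2 - s.
Definition hermite4 (x s : R) : R := x ^+ 4 - 6%:R * s * x ^+ 2 + 3%:R * s ^+ 2.

(* Integral over T^d w.r.t. normalized Lebesgue measure dx = (2pi)^{-d} dx_Leb,
   written as iterated integrals over [0, 2pi] (coordinates 0..d-1). *)
Fixpoint torus_int (d : nat) (f : (nat -> R) -> R) : R :=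
  match d with
  | 0 => f (fun _ => 0)
  | d'.+1 => (pi *+ 2)^-1 *
      Rintegral (@lebesgue_measure R) `[0, pi *+ 2]
        (fun t => torus_int d' (fun x => f (fun i => if i == d' then t else x i)))
  end.

Definition mutually_independent (dT : measure_display) (T : measurableType dT)
    (P : probability T R) (I : eqType) (X : I -> T -> R) : Prop :=
  forall (S : seq I) (B : I -> set R), uniq S -> (forall i, measurable (B i)) ->
    P (\bigcap_(i in [set` S]) (X i @^-1` B i)) =
    (\prod_(i <- S) P (X i @^-1` B i))%E.

(* The standard complex Gaussians conditioned on g_{-n} = conj(g_n), built from
   independent standard real Gaussians X (false, n) = a_n, X (true, n) = b_n:
   g_n = (a_n + a_{-n})/2 + i (b_n - b_{-n})/2.
   (g_0 = a_0 is standard real; for n <> 0, Re g_n, Im g_n are independent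
   N(0,1/2), so g_n is standard complex; pairs {n,-n} are independent.) *)
Definition gRe (T : Type) d (X : bool * lattice d -> T -> R) (n : lattice d) (w : T) : R :=
  (X (false, n) w + X (false, lneg n) w) / 2.
Definition gIm (T : Type) d (X : bool * lattice d -> T -> R) (n : lattice d) (w : T) : R :=
  (X (true, n) w - X (true, lneg n) w) / 2.

(* u_N(x) = sum_{|n|<=N} <n>^{-d/2} g_n e^{i n.x}
          = sum_{|n|<=N} <n>^{-d/2} Re(g_n e^{i n.x})   (the sum is real). *)
Definition uN (T : Type) d (X : bool * lattice d -> T -> R) (N : nat) (w : T)
    (x : nat -> R) : R :=
  sum_ball (d:=d) N (fun n => powR (jbr n) (- (d%:R / 2)) *
     (gRe X n w * cos (ldot n x) - gIm X n w * sin (ldot n x))).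

Definition wick2_mass (T : Type) d (X : bool * lattice d -> T -> R) N (w : T) : R :=
  torus_int d (fun x => hermite2 (uN X N w x) (sigmaN d N)).

Definition RN (T : Type) d (X : bool * lattice d -> T -> R) (sigma : R) N (w : T) : R :=
  sigma / 4%:R * torus_int d (fun x => hermite4 (uN X N w x) (sigmaN d N)).

End Defs.

(* Main.v *)
Require Import Defs.
From HB Require Import structures.
From mathcomp Require Import all_boot all_order all_algebra.
From mathcomp Require Import all_classical all_reals all_analysis.
From mathcomp Require Import measurable_realfun complex ring lra zify.
Import Order.TTheory GRing.Theory Num.Theory.
Import numFieldNormedType.Exports.
Local Open Scope classical_set_scope.
Local Open Scope ring_scope.
Set Implicit Arguments. Unset Strict Implicit. Unset Printing Implicit Defensive.

(** Let [s] be the variance [sigmaN], of order [log N].  A product of Dirichlet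
    kernels of degree of order [N], scaled so that its mean square is exactly [s],
    has vanishing Wick-ordered mass, while the integral of its fourth power is of
    order [N^d s^2].  Forcing every Gaussian coefficient to lie within a negative
    power of [N] of the coefficient of this profile keeps [u_N] uniformly close to
    the profile, and costs only a probability [exp(- C N^d log N)]: there are
    [O(N^d)] coefficients, each contributes [log N] to the exponent through the
    width of its window, and the Gaussian density contributes [O(N^d s)] in total.
    On this event the cutoff holds and [R_N >= c N^d s^2], which beats the cost by
    a factor [log N]. *)

Section Trigonometry.
Context {R : realType}.
Implicit Types x y : R.

Lemma cos_lipschitz x y : `|cos x - cos y| <= `|x - y|.
Proof.
wlog yx : x y / y <= x.
  move=> H; have [yx|/ltW xy] := leP y x; first exact: H.
  by rewrite distrC (distrC x); exact: H.
have cd z : z \in `]y, x[ -> is_derive z 1 (@cos R) (- sin z).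
  by move=> _; exact: is_derive_cos.
have cc : {within `[y, x], continuous (@cos R)}.
  exact/continuous_subspaceT/continuous_cos.
have [c _ ->] := MVT_segment yx cd cc.
by rewrite normrM ler_piMl// normrN sin_max.
Qed.

Lemma sin_lipschitz x y : `|sin x - sin y| <= `|x - y|.
Proof.
wlog yx : x y / y <= x.
  move=> H; have [yx|/ltW xy] := leP y x; first exact: H.
  by rewrite distrC (distrC x); exact: H.
have cd z : z \in `]y, x[ -> is_derive z 1 (@sin R) (cos z).
  by move=> _; exact: is_derive_sin.
have cc : {within `[y, x], continuous (@sin R)}.
  exact/continuous_subspaceT/continuous_sin.
have [c _ ->] := MVT_segment yx cd cc.
by rewrite normrM ler_piMl// cos_max.
Qed.

Lemma cos_ge_half x : `|x| <= 1 -> 2^-1 <= cos x.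
Proof.
move=> x1.
have sx : `|sin (x / 2)| <= 2^-1.
  have := sin_lipschitz (x / 2) 0.
  rewrite sin0 !subr0 => /le_trans; apply.
  by rewrite normrM normfV (ger0_norm (_ : 0 <= 2)) //; lra.
have -> : cos x = 1 - 2 * sin (x / 2) ^+ 2.
  have -> : x = x / 2 + x / 2 by lra.
  rewrite cosD -!expr2 cos2sin2 (_ : (x / 2 + x / 2) / 2 = x / 2); lra.
have : `|sin (x / 2)| ^+ 2 <= 2^-1 ^+ 2 by rewrite ler_sqr ?nnegrE.
rewrite real_normK ?num_real//; lra.
Qed.

Lemma cos_int_pi2 (z : int) : cos (z%:~R * (pi *+ 2)) = 1 :> R /\
  sin (z%:~R * (pi *+ 2)) = 0 :> R.
Proof.
wlog : z / (0 <= z)%R.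
  move=> H; have [/H//|/ltW z0] := leP 0%R z.
  have [] := H (- z); first by lia.
  rewrite mulrNz mulNr cosN sinN => -> s0; split=> //.
  by apply/eqP; rewrite -oppr_eq0 s0.
case: z => // n _; elim: n => [|n [c s]].
  by rewrite mul0r cos0 sin0.
have -> : (Posz n.+1)%:~R * (pi *+ 2) = (Posz n)%:~R * (pi *+ 2) + pi + pi :> R.
  by rewrite -!pmulrn -addn1 natrD; ring.
by rewrite !cosDpi !sinDpi !opprK.
Qed.

End Trigonometry.

Section TorusIntegral.
Context {R : realType}.
Local Notation mu := (@lebesgue_measure R).
Local Notation period := `[0, pi *+ 2 : R]%classic.

Lemma pi2_gt0 : 0 < pi *+ 2 :> R.
Proof. by rewrite pmulrn_lgt0 ?pi_gt0. Qed.

Lemma lipschitz_integrable (C : R) (h : R -> R) :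
  (forall s t, `|h s - h t| <= C * `|s - t|) ->
  mu.-integrable period (EFin \o h).
Proof.
move=> hC; apply: continuous_compact_integrable; first exact: segment_compact.
apply: continuous_subspaceT => x.
have C0 : 0 <= C.
  by have := hC 1 0; rewrite subr0 normr1 mulr1; exact: le_trans.
apply/cvgrPdist_le => e e0; near=> y.
rewrite (le_trans (hC _ _))//.
rewrite (@le_trans _ _ ((C + 1) * `|x - y|))//.
  by rewrite ler_wpM2r// lerDl.
rewrite mulrC -ler_pdivlMr ?ltr_wpDl//.
near: y; have eC : 0 < e / (C + 1) by rewrite divr_gt0// ltr_wpDl.
by apply/nbhs_ballP; exists (e / (C + 1)) => // z /ltW.
Unshelve. all: by end_near. Qed.

Definition tlip (d : nat) (f : (nat -> R) -> R) : Prop := exists C,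
  (forall x, `|f x| <= C) /\
  forall x y, `|f x - f y| <= C * \sum_(i < d) `|x i - y i|.

Lemma tlip_ext d f g : f =1 g -> tlip d f -> tlip d g.
Proof. by move=> fg [C [b l]]; exists C; split=> *; rewrite -!fg. Qed.

Lemma tlip_cst d c : tlip d (fun=> c).
Proof.
exists `|c|; split=> // x y; rewrite subrr normr0 mulr_ge0// sumr_ge0// => i _.
Qed.

Lemma tlipD d f g : tlip d f -> tlip d g -> tlip d (fun x => f x + g x).
Proof.
move=> [C [fb fl]] [D [gb gl]]; exists (C + D); split=> [x|x y].
  by rewrite (le_trans (ler_normD _ _))// lerD.
rewrite opprD addrACA (le_trans (ler_normD _ _))// mulrDl lerD//.
Qed.

Lemma tlipM d f g : tlip d f -> tlip d g -> tlip d (fun x => f x * g x).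
Proof.
move=> [C [fb fl]] [D [gb gl]].
have C0 : 0 <= C by rewrite (le_trans _ (fb (fun=> 0))).
have D0 : 0 <= D by rewrite (le_trans _ (gb (fun=> 0))).
exists (C * D *+ 2); split=> [x|x y].
  rewrite normrM (@le_trans _ _ (C * D))//; first by rewrite ler_pM.
  by rewrite mulr2n lerDl mulr_ge0.
rewrite (_ : _ - _ = f x * (g x - g y) + (f x - f y) * g y); last by ring.
rewrite (le_trans (ler_normD _ _))// !normrM mulr2n mulrDl lerD//.
  by rewrite -mulrA ler_pM.
by rewrite (mulrC C) -mulrA mulrC ler_pM.
Qed.

Lemma tlip_sum d (I : Type) (r : seq I) (Q : pred I) (F : I -> (nat -> R) -> R) :
  (forall i, Q i -> tlip d (F i)) -> tlip d (fun x => \sum_(i <- r | Q i) F i x).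
Proof.
move=> FQ; elim: r => [|i r IH].
  by apply: tlip_ext (tlip_cst d 0) => x; rewrite big_nil.
have [Qi|Qi] := boolP (Q i).
  by apply: tlip_ext (tlipD (FQ _ Qi) IH) => x; rewrite big_cons Qi.
by apply: tlip_ext IH => x; rewrite big_cons (negPf Qi).
Qed.

Lemma tlip_prod d (I : Type) (r : seq I) (Q : pred I) (F : I -> (nat -> R) -> R) :
  (forall i, Q i -> tlip d (F i)) -> tlip d (fun x => \prod_(i <- r | Q i) F i x).
Proof.
move=> FQ; elim: r => [|i r IH].
  by apply: tlip_ext (tlip_cst d 1) => x; rewrite big_nil.
have [Qi|Qi] := boolP (Q i).
  by apply: tlip_ext (tlipM (FQ _ Qi) IH) => x; rewrite big_cons Qi.
by apply: tlip_ext IH => x; rewrite big_cons (negPf Qi).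
Qed.

Lemma tlipX d f n : tlip d f -> tlip d (fun x => f x ^+ n).
Proof.
move=> lf; elim: n => [|n IH]; first exact: tlip_ext (tlip_cst d 1).
by apply: tlip_ext (tlipM lf IH) => x; rewrite exprS.
Qed.

Lemma tlip_comp_ldot d (h : R -> R) (n : lattice d) :
  (forall s, `|h s| <= 1) -> (forall s t, `|h s - h t| <= `|s - t|) ->
  tlip d (fun x => h (ldot n x)).
Proof.
move=> hb hl; set C := \sum_(i < d) `|(n i)%:~R : R|.
have C0 : 0 <= C by apply: sumr_ge0 => i _.
exists (1 + C); split=> [x|x y]; first by rewrite (le_trans (hb _))// lerDl.
rewrite (le_trans (hl _ _))// /ldot -sumrB (le_trans (ler_norm_sum _ _ _))//.
rewrite mulr_sumr; apply: ler_sum => i _; rewrite -mulrBr normrM ler_wpM2r//.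
by rewrite (@le_trans _ _ C)// ?lerDr// /C (bigD1 i)//= lerDl sumr_ge0.
Qed.

Lemma tlip_coord d (h : R -> R) C i : (i < d)%N ->
  (forall s, `|h s| <= C) -> (forall s t, `|h s - h t| <= C * `|s - t|) ->
  tlip d (fun x => h (x i)).
Proof.
move=> id hb hl; exists C; split=> // x y; rewrite (le_trans (hl _ _))//.
rewrite ler_wpM2l//; first by rewrite (le_trans _ (hb 0)).
by rewrite (bigD1 (Ordinal id))//= lerDl sumr_ge0.
Qed.

Definition slice (d : nat) (f : (nat -> R) -> R) (t : R) : (nat -> R) -> R :=
  fun x => f (fun i => if i == d then t else x i).

Lemma tlip_slice d f t : tlip d.+1 f -> tlip d (slice d f t).
Proof.
move=> [C [fb fl]]; exists C; split=> [x|x y]; first exact: fb.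
rewrite /slice (le_trans (fl _ _))// ler_wpM2l//.
  by rewrite (le_trans _ (fb (fun=> 0))).
rewrite big_ord_recr/= eqxx subrr normr0 addr0.
by apply: ler_sum => i _; rewrite ltn_eqF.
Qed.

Lemma torus_int_step d f : torus_int d.+1 f =
  (pi *+ 2)^-1 * \int[mu]_(t in period) torus_int d (slice d f t).
Proof. by []. Qed.

Lemma torus_int_ext d (f g : (nat -> R) -> R) : f =1 g -> torus_int d f = torus_int d g.
Proof. by move=> /funext ->. Qed.

Lemma torus_int_linear d :
  (forall c : R, torus_int d (fun=> c : R) = c) /\
  (forall f g : (nat -> R) -> R, tlip d f -> tlip d g ->
    (forall x, f x <= g x) -> torus_int d f <= torus_int d g) /\
  (forall a (f g : (nat -> R) -> R), tlip d f -> tlip d g ->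
    torus_int d (fun x => a * f x + g x) = a * torus_int d f + torus_int d g).
Proof.
elim: d => [|d [cst [mono lin]]].
  by split=> //; split=> [f g _ _|//]; apply.
have slip f : tlip d.+1 f ->
    mu.-integrable period (EFin \o (fun t => torus_int d (slice d f t))).
  move=> lf; have ls t := tlip_slice t lf.
  have [C [_ fl]] := lf.
  apply: (@lipschitz_integrable C).
  have half s t : torus_int d (slice d f s) - torus_int d (slice d f t) <=
                  C * `|s - t|.
    rewrite lerBlDr -{1}(cst (C * `|s - t|)) -[X in X + _]mul1r addrC -addrC -lin//;
      last exact: tlip_cst.
    apply: mono => //.
      by apply: tlipD => //; apply: tlipM; exact: tlip_cst.
    move=> x; rewrite mul1r -lerBlDr (le_trans (ler_norm _))//.
    rewrite (le_trans (fl _ _))// big_ord_recr/= eqxx big1 ?add0r// => i _.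
    by rewrite ltn_eqF// subrr normr0.
  by move=> s t; rewrite ler_norml half andbT lerNl opprB distrC half.
have P0 := pi2_gt0.
split; [|split].
- move=> c; rewrite torus_int_step; under eq_Rintegral do rewrite /slice cst.
  rewrite Rintegral_cst//= lebesgue_measure_itv/= lte_fin P0/= subr0.
  by rewrite mulrC mulfK// gt_eqF.
- move=> f g lf lg fg; rewrite !torus_int_step ler_wpM2l//.
    by rewrite invr_ge0 ltW.
  apply: (le_Rintegral _ (slip _ lf) (slip _ lg)) => //.
  by move=> t _; apply: mono; [exact: tlip_slice|exact: tlip_slice|move=> x; exact: fg].
- move=> a f g lf lg; rewrite !torus_int_step.
  under eq_Rintegral => t _.
    rewrite (_ : torus_int d _ = a * torus_int d (slice d f t) +
                                 torus_int d (slice d g t)); last first.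
      by rewrite -lin//; exact: tlip_slice.
    over.
  have If := slip _ lf; have Ig := slip _ lg.
  rewrite RintegralD//; last first.
    by have := integrableZl _ a If; exact.
  by rewrite RintegralZl// mulrDr mulrCA.
Qed.

Lemma torus_int_cst d c : torus_int d (fun=> c : R) = c.
Proof. by case: (torus_int_linear d). Qed.

Lemma le_torus_int d f g : tlip d f -> tlip d g -> (forall x, f x <= g x) ->
  torus_int d f <= torus_int d g.
Proof. by case: (torus_int_linear d) => _ [+ _]; apply. Qed.

Lemma torus_intMD d a f g : tlip d f -> tlip d g ->
  torus_int d (fun x => a * f x + g x) = a * torus_int d f + torus_int d g.
Proof. by case: (torus_int_linear d) => _ [_]; apply. Qed.

Lemma torus_intZ d a f : tlip d f ->
  torus_int d (fun x => a * f x) = a * torus_int d f.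
Proof.
move=> lf; rewrite -[RHS]addr0 -[X in _ + X](torus_int_cst d) -torus_intMD//.
  by apply: torus_int_ext => x; rewrite addr0.
exact: tlip_cst.
Qed.

Lemma torus_int_prod d (h : R -> R) C :
  (forall s, `|h s| <= C) -> (forall s t, `|h s - h t| <= C * `|s - t|) ->
  torus_int d (fun x => \prod_(i < d) h (x i)) =
  ((pi *+ 2)^-1 * \int[mu]_(t in period) h t) ^+ d.
Proof.
move=> hb hl; elim: d => [|d IH]; first by rewrite /= big_ord0 expr0.
rewrite torus_int_step; under eq_Rintegral => t _.
  rewrite (_ : torus_int d _ =
      h t * torus_int d (fun x => \prod_(i < d) h (x i))); last first.
    rewrite -torus_intZ; last first.
      by apply: tlip_prod => i _; apply: tlip_coord hb hl.
    apply: torus_int_ext => x; rewrite /slice big_ord_recr/= eqxx mulrC.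
    by congr (_ * _); apply: eq_bigr => i _; rewrite ltn_eqF.
  over.
rewrite RintegralZr//; last exact: lipschitz_integrable hl.
by rewrite IH exprS mulrA.
Qed.

End TorusIntegral.

Section NonnegativeIntegral.
Context {R : realType}.

(* The integral of a nonnegative function is a supremum over the simple
   functions below it, so monotonicity needs no measurability. *)
Lemma ge0_le_integral_any (dT : measure_display) (T : measurableType dT)
    (mu : {measure set T -> \bar R}) (D : set T) (f g : T -> \bar R) :
  (forall x, D x -> 0 <= f x)%E -> (forall x, D x -> f x <= g x)%E ->
  (\int[mu]_(x in D) f x <= \int[mu]_(x in D) g x)%E.
Proof.
move=> f0 fg; rewrite !ge0_integralE//; last first.
  by move=> x Dx; rewrite (le_trans (f0 _ Dx))// fg.
apply: le_ereal_sup => _ [h hf <-]; exists h => // x.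
rewrite (le_trans (hf x))// /patch; case: ifPn => // /set_mem; exact: fg.
Qed.

End NonnegativeIntegral.

Section Dirichlet.
Context {R : realType}.
Local Notation mu := (@lebesgue_measure R).
Local Notation period := `[0, pi *+ 2 : R]%classic.

Lemma torus_int_sum d (I : Type) (r : seq I) (Q : pred I)
    (F : I -> (nat -> R) -> R) : (forall i, Q i -> tlip d (F i)) ->
  torus_int d (fun x => \sum_(i <- r | Q i) F i x) =
  \sum_(i <- r | Q i) torus_int d (F i).
Proof.
move=> FQ; elim: r => [|i r IH].
  rewrite big_nil -[RHS](torus_int_cst d).
  by apply: torus_int_ext => x; rewrite big_nil.
have [Qi|Qi] := boolP (Q i); last first.
  rewrite big_cons (negPf Qi) -IH.
  by apply: torus_int_ext => x; rewrite big_cons (negPf Qi).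
rewrite big_cons Qi -IH -[X in X + _]mul1r -torus_intMD//; last exact: tlip_sum.
- by apply: torus_int_ext => x; rewrite big_cons Qi mul1r.
- exact: FQ.
Qed.

Lemma tlip_cos_coord (z : int) : tlip 1 (fun x : nat -> R => cos (z%:~R * x 0%N)).
Proof.
have -> : (fun x : nat -> R => cos (z%:~R * x 0%N)) =
          (fun x => cos (ldot (([ffun=> z]) : lattice 1) x)).
  by apply/funext => x; rewrite /ldot big_ord1 ffunE.
by apply: tlip_comp_ldot => *; [exact: cos_max|exact: cos_lipschitz].
Qed.

Lemma torus_int1E (h : R -> R) : torus_int 1 (fun x => h (x 0%N)) =
  (pi *+ 2)^-1 * \int[mu]_(t in period) h t.
Proof. by []. Qed.

Lemma torus_int_cos (z : int) :
  torus_int 1 (fun x : nat -> R => cos (z%:~R * x 0%N)) = (z == 0)%:R.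
Proof.
have [->|z0] := eqVneq z 0.
  rewrite -[RHS](torus_int_cst 1); apply: torus_int_ext => x.
  by rewrite mul0r cos0.
rewrite (torus_int1E (fun t => cos (z%:~R * t))) /Rintegral.
have zR : (z%:~R : R) != 0 by rewrite intr_eq0.
have dF (x : R) : is_derive x 1 (fun t : R => sin (z%:~R * t) / z%:~R) (cos (z%:~R * x)).
  apply: is_derive_eq.
  by rewrite /GRing.scale/= !mulr0 add0r mulr1 mulrCA mulVf ?mulr1.
have cF : continuous (fun t : R => sin (z%:~R * t) / z%:~R).
  by move=> x; apply/differentiable_continuous/derivable1_diffP; have [] := dF x.
rewrite (@continuous_FTC2 _ _ (fun t => sin (z%:~R * t) / z%:~R)).
- by rewrite mulr0 sin0 (cos_int_pi2 z).2 !mul0r /= subr0 mulr0.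
- exact: pi2_gt0.
- apply: continuous_subspaceT => x.
  apply: continuous_comp; last exact: continuous_cos.
  by apply: cvgM; [exact: cvg_cst|exact: cvg_id].
- split.
  + by move=> x _; have [] := dF x.
  + by apply: cvg_at_right_filter; exact: cF.
  + by apply: cvg_at_left_filter; exact: cF.
- by move=> x _; rewrite derive1E; apply/derive_val.
Qed.

Variables N m : nat.

Definition low_freq : pred 'I_(N.*2.+1) :=
  [pred k : 'I_(N.*2.+1) | (N <= k + m)%N && (k <= N + m)%N].

Local Notation q := (#|low_freq|%:R : R).

Definition dirichlet (t : R) : R :=
  \sum_(k | low_freq k) cos (((k : nat)%:Z - N%:Z)%:~R * t).

Lemma low_freq_rev k : low_freq (rev_ord k) = low_freq k.
Proof. by rewrite /low_freq /=; have := ltn_ord k; lia. Qed.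

Lemma rev_ord_freq (k : 'I_(N.*2.+1)) :
  (rev_ord k : nat)%:Z - N%:Z = - ((k : nat)%:Z - N%:Z).
Proof. by rewrite /=; have := ltn_ord k; lia. Qed.

Lemma card_low_freq_ge : (m <= N)%N -> (m <= #|low_freq|)%N.
Proof.
move=> mN; have lt (i : 'I_m) : (N + i < N.*2.+1)%N by have := ltn_ord i; lia.
rewrite -[X in (X <= _)%N](card_ord m).
apply: leq_trans (_ : #|codom (fun i => Ordinal (lt i))| <= _)%N.
  by rewrite card_codom// => i j [] /addnI /val_inj.
apply/subset_leq_card/fintype.subsetP => _ /codomP[i ->].
by rewrite inE /=; have := ltn_ord i; lia.
Qed.

Lemma card_low_freq_le : (#|low_freq| <= N.*2.+1)%N.
Proof. by rewrite -[X in (_ <= X)%N](card_ord (N.*2.+1)) max_card. Qed.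

Lemma tlip_dirichletX n : tlip 1 (fun x : nat -> R => dirichlet (x 0%N) ^+ n).
Proof. by apply/tlipX/tlip_sum => i _; exact: tlip_cos_coord. Qed.

Lemma norm_dirichlet_le t : `|dirichlet t| <= q.
Proof.
rewrite (le_trans (ler_norm_sum _ _ _))// (le_trans (ler_sum _ (G := fun=> 1) _))//.
  by move=> i _; exact: cos_max.
by rewrite sumr_const.
Qed.

Lemma dirichlet_mass : torus_int 1 (fun x => dirichlet (x 0%N) ^+ 2) = q.
Proof.
pose cc (z : int) (x : nat -> R) := cos (z%:~R * x 0%N).
pose fr (k : 'I_(N.*2.+1)) := (k : nat)%:Z - N%:Z.
have -> : torus_int 1 (fun x => dirichlet (x 0%N) ^+ 2) =
  torus_int 1 (fun x => \sum_(j | low_freq j) \sum_(k | low_freq k)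
    (2^-1 * cc (fr j - fr k) x + 2^-1 * cc (fr j + fr k) x)).
  apply: torus_int_ext => x; rewrite expr2 /dirichlet mulr_suml.
  apply: eq_bigr => j _; rewrite mulr_sumr; apply: eq_bigr => k _.
  rewrite -/(fr j) -/(fr k) /cc intrB mulrBl cosB intrD mulrDl cosD.
  by field.
have lc z : tlip 1 (fun x => 2^-1 * cc z x).
  by apply: tlipM; [exact: tlip_cst|exact: tlip_cos_coord].
rewrite torus_int_sum; last first.
  by move=> j _; apply: tlip_sum => k _; apply: tlipD.
transitivity (\sum_(j | low_freq j) 1 : R); last by rewrite sumr_const.
apply: eq_bigr => j Sj; rewrite torus_int_sum; last by move=> k _; apply: tlipD.
transitivity (\sum_(k | low_freq k) (2^-1 * (k == j)%:R + 2^-1 * (k == rev_ord j)%:R) : R).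
  apply: eq_bigr => k _.
  rewrite torus_intMD; [|exact: tlip_cos_coord|exact: lc].
  rewrite torus_intZ; last exact: tlip_cos_coord.
  rewrite !torus_int_cos; congr (_ * _%:R + _ * _%:R); congr nat_of_bool.
    by rewrite /fr -val_eqE/=; lia.
  by rewrite /fr -val_eqE/=; have := ltn_ord j; have := ltn_ord k; lia.
rewrite big_split/= -!mulr_sumr.
have one j' : low_freq j' -> \sum_(k | low_freq k) ((k == j')%:R : R) = 1.
  move=> Sj'; rewrite (bigD1 j')//= eqxx big1 ?addr0// => k /andP[_ /negPf ->//].
by rewrite !one ?low_freq_rev//; lra.
Qed.

Lemma dirichlet_quartic : (0 < m)%N ->
  (pi *+ 2)^-1 * (q / 2) ^+ 4 / m%:R <=
  torus_int 1 (fun x => dirichlet (x 0%N) ^+ 4).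
Proof.
move=> m0; have m0R : 0 < m%:R :> R by rewrite ltr0n.
rewrite (torus_int1E (fun t => dirichlet t ^+ 4)) -mulrA ler_wpM2l//.
  by rewrite invr_ge0 ltW// pi2_gt0.
have big t : 0 <= t <= m%:R^-1 -> (q / 2) ^+ 4 <= dirichlet t ^+ 4.
  move=> /andP[t0 tm].
  have : q / 2 <= dirichlet t.
    rewrite -sumr_const mulr_suml; apply: ler_sum => k /andP[kl kr].
    rewrite mul1r; apply: cos_ge_half.
    rewrite normrM (ger0_norm t0) -[leRHS](mulfV (lt0r_neq0 m0R)) ler_pM//.
    by rewrite -intr_norm (_ : m%:R = (m%:Z)%:~R) // ler_int; lia.
  by move=> h; rewrite lerXn2r ?nnegrE ?(le_trans _ h) ?divr_ge0.
have [C [hb hl]] := tlip_dirichletX 4.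
have int4 : mu.-integrable period (EFin \o (fun t => dirichlet t ^+ 4)).
  apply: (@lipschitz_integrable _ C) => s t.
  by have := hl (fun=> s) (fun=> t); rewrite big_ord1.
rewrite -lee_fin /Rintegral fineK; last exact: integrable_fin_num.
have mp : m%:R^-1 <= pi *+ 2 :> R.
  rewrite (@le_trans _ _ 1)//; first by rewrite invf_le1// ler1n.
  by rewrite mulr2n; have := pi_ge2 R; lra.
apply: (@le_trans _ _
  (\int[mu]_(t in period) ((q / 2) ^+ 4 * \1_(`[0, m%:R^-1]%classic) t)%:E)%E).
  under eq_integral do rewrite EFinM.
  rewrite ge0_integralZl//=; last first.
    by apply/measurable_EFinP; exact: measurable_indic.
  rewrite integral_indic// setIidl; last first.
    by move=> t /=; rewrite !in_itv/= => /andP[-> /le_trans]; apply.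
  by rewrite /= lebesgue_measure_itv/= lte_fin invr_gt0 m0R /= oppr0 adde0 -EFinM.
apply: ge0_le_integral_any => t _; rewrite lee_fin.
  by rewrite mulr_ge0// exprn_ge0// divr_ge0.
rewrite /= indicE; case: (boolP (t \in _)) => [/set_mem/=|_]; rewrite ?mulr0 ?mulr1.
  by rewrite in_itv/=; exact: big.
by rewrite exprn_even_ge0.
Qed.

Lemma prod_dirichlet d (x : nat -> R) :
  \prod_(i < d) dirichlet (x i) =
  \sum_(k : {ffun 'I_d -> 'I_(N.*2.+1)} | k \in ffun_on low_freq)
    cos (ldot (boxpt k) x).
Proof.
pose e (t : R) : complex.complex R := complex.Complex (cos t) (sin t).
have eD s t : e (s + t) = e s * e t.
  by apply/eqP; rewrite complex.eq_complex/= cosD sinD addrC [X in _ && (X == _)]addrC !eqxx.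
have e0 : e 0 = 1 by rewrite /e cos0 sin0.
have ReD (I : Type) (r : seq I) (Q : pred I) (F : I -> complex.complex R) :
    complex.Re (\sum_(i <- r | Q i) F i) = \sum_(i <- r | Q i) complex.Re (F i).
  by apply: (big_morph (@complex.Re R)) => // -[a b] [a' b'].
have ImD (I : Type) (r : seq I) (Q : pred I) (F : I -> complex.complex R) :
    complex.Im (\sum_(i <- r | Q i) F i) = \sum_(i <- r | Q i) complex.Im (F i).
  by apply: (big_morph (@complex.Im R)) => // -[a b] [a' b'].
have dirE t : \sum_(k | low_freq k) e (((k : nat)%:Z - N%:Z)%:~R * t) =
    complex.Complex (dirichlet t) 0.
  apply/eqP; rewrite complex.eq_complex ReD ImD eqxx/=.
  set s := (X in X == 0).
  suff : s = - s by move=> h; apply/eqP; lra.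
  rewrite {1}/s (reindex_inj rev_ord_inj)/= -sumrN.
  apply: eq_big => k; first exact: low_freq_rev.
  by move=> _; rewrite -sinN -mulNr -intrN -rev_ord_freq.
transitivity (complex.Re (\prod_(i < d) \sum_(k | low_freq k)
    e (((k : nat)%:Z - N%:Z)%:~R * x i))).
  rewrite (eq_bigr (fun i : 'I_d => complex.Complex (dirichlet (x i)) 0));
    last by move=> i _; exact: dirE.
  have -> : \prod_(i < d) complex.Complex (dirichlet (x i)) 0 =
            complex.Complex (\prod_(i < d) dirichlet (x i)) 0.
    apply/esym; apply: (big_morph (fun a : R => complex.Complex a 0)) => // a b.
    by apply/eqP; rewrite complex.eq_complex/= !mul0r !mulr0 subr0 addr0 !eqxx.
  by [].
rewrite bigA_distr_big ReD; apply: eq_bigr => k _.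
rewrite -(big_morph e eD e0) /=.
by congr cos; rewrite /ldot; apply: eq_bigr => i _; rewrite ffunE.
Qed.

End Dirichlet.
Arguments low_freq : clear implicits.

Section Variance.
Context {R : realType}.

Lemma geometric_sum_le2 (x : R) J : 0 <= x <= 2^-1 -> \sum_(j < J) x ^+ j <= 2.
Proof.
move=> /andP[x0 x2]; elim: J => [|J IH]; first by rewrite big_ord0.
rewrite big_ord_recl expr0; under eq_bigr do rewrite /= exprS.
rewrite -mulr_sumr.
have : x * \sum_(i < J) x ^+ i <= 2^-1 * 2.
  by rewrite ler_pM// sumr_ge0// => i _; rewrite exprn_ge0.
lra.
Qed.

Lemma geometric_tail_le (x y : R) J (Q : pred nat) : 0 < x <= 2^-1 -> 0 <= y ->
  (forall j, Q j -> x ^+ j <= y) -> \sum_(j < J | Q j) x ^+ j <= 2 * y.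
Proof.
move=> xx; have /andP[x0 x2] := xx.
elim: J y Q => [|J IH] y Q y0 Qy; first by rewrite big_ord0; lra.
rewrite big_mkcond big_ord_recl /= -big_mkcond.
have [Q0|Q0] := boolP (Q 0%N).
  have y1 : 1 <= y by have := Qy _ Q0; rewrite expr0.
  have : \sum_(j < J.+1) x ^+ j <= 2 by apply: geometric_sum_le2; rewrite ltW.
  rewrite big_ord_recl expr0 /= => h.
  have : \sum_(i < J | Q (bump 0 i)) x ^+ bump 0 i <= \sum_(i < J) x ^+ bump 0 i.
    rewrite big_mkcond; apply: ler_sum => i _; case: ifP => // _.
    by rewrite exprn_ge0// ltW.
  lra.
rewrite add0r; under eq_bigr do rewrite /bump/= exprS.
rewrite -mulr_sumr.
have := IH (y / x) (fun j => Q j.+1).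
have -> : 2 * y = x * (2 * (y / x)) by field; rewrite gt_eqF.
move=> H; apply: ler_wpM2l; [exact: ltW|apply: H].
  by rewrite divr_ge0// ltW.
by move=> j Qj; rewrite ler_pdivlMr// -exprSr; exact: Qy.
Qed.

Lemma jbr_sqr d (n : lattice d) : jbr R n ^+ 2 = 1 + lnorm2 R n :> R.
Proof.
by rewrite sqr_sqrtr// addr_ge0// sumr_ge0// => i _; rewrite sqr_ge0.
Qed.

Lemma jbr_ge1 d (n : lattice d) : 1 <= jbr R n :> R.
Proof.
rewrite -[leLHS]sqrtr1 ler_sqrt ?lerDl.
  by rewrite sumr_ge0// => i _; rewrite sqr_ge0.
by rewrite addr_ge0// sumr_ge0// => i _; rewrite sqr_ge0.
Qed.

Lemma jbr_gt0 d (n : lattice d) : 0 < jbr R n.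
Proof. exact: lt_le_trans (jbr_ge1 n). Qed.

Lemma lnorm2_boxpt_le d N m (k : {ffun 'I_d -> 'I_(N.*2.+1)}) :
  k \in ffun_on (low_freq N m) -> lnorm2 R (boxpt k) <= d%:R * m%:R ^+ 2 :> R.
Proof.
move=> /ffun_onP kS; rewrite /lnorm2.
have -> : d%:R * m%:R ^+ 2 = \sum_(i < d) (m%:R ^+ 2) :> R.
  by rewrite sumr_const card_ord mulr_natl.
apply: ler_sum => i _; rewrite ffunE.
have := kS i; rewrite inE /= => /andP[kl kr].
rewrite -[leLHS]real_normK ?num_real// lerXn2r ?nnegrE//.
by rewrite -intr_norm (_ : m%:R = (m%:Z)%:~R) // ler_int; lia.
Qed.

Lemma jbr_boxpt_le d N m (k : {ffun 'I_d -> 'I_(N.*2.+1)}) : (0 < m)%N ->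
  k \in ffun_on (low_freq N m) -> jbr R (boxpt k) <= d.+1%:R * m%:R :> R.
Proof.
move=> m0 kS; rewrite -ler_sqr ?nnegrE ?sqrtr_ge0 ?mulr_ge0//.
rewrite jbr_sqr exprMn.
have := @lnorm2_boxpt_le _ _ _ _ kS.
have m1 : 1 <= m%:R :> R by rewrite ler1n.
have d0 : 0 <= d%:R :> R by [].
have -> : d.+1%:R = d%:R + 1 :> R by rewrite -natr1.
nra.
Qed.

Lemma box_sub_ball d N m M (k : {ffun 'I_d -> 'I_(N.*2.+1)}) : (0 < d)%N ->
  N = (d * M)%N -> (m <= M)%N -> k \in ffun_on (low_freq N m) ->
  lnorm2 R (boxpt k) <= N%:R ^+ 2 :> R.
Proof.
move=> d0 NE mM /lnorm2_boxpt_le /le_trans; apply.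
rewrite NE natrM exprMn ler_pM// ?exprn_ge0//.
  by rewrite ler_eXnr// ler1n.
by rewrite lerXn2r ?nnegrE// ler_nat.
Qed.

Lemma sigmaN_ge_log d J : (0 < d)%N ->
  J%:R / (2 * d.+1%:R ^+ d) <= sigmaN R d (d * 2 ^ J).
Proof.
move=> d0; set N := (d * 2 ^ J)%N; set x : R := 2^-1 ^+ d.
have x01 : 0 < x <= 2^-1.
  by rewrite exprn_gt0//= -[leRHS]expr1 ler_wiXn2l//; lra.
set D : R := d.+1%:R ^+ d.
have D0 : 0 < D by rewrite exprn_gt0.
pose box j (k : {ffun 'I_d -> 'I_(N.*2.+1)}) := k \in ffun_on (low_freq N (2 ^ j)).
rewrite /sigmaN /sum_ball.
have term k : \sum_(j < J | box j k) x ^+ j <= 2 * (D / jbr R (boxpt k) ^+ d).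
  apply: (@geometric_tail_le _ _ _ (box^~ k)) => //.
    by rewrite divr_ge0 ?(ltW D0)// exprn_ge0// sqrtr_ge0.
  move=> j /jbr_boxpt_le => /(_ (expn_gt0 _ _)) h.
  have j0 : 0 < jbr R (boxpt k) by exact: jbr_gt0.
  rewrite ler_pdivlMr ?exprn_gt0// /x -exprM mulnC exprM -exprMn /D.
  rewrite lerXn2r ?nnegrE ?mulr_ge0 ?exprn_ge0 ?(ltW j0)//.
  by rewrite exprVn mulrC ler_pdivrMr ?exprn_gt0// -natrX.
apply: (@le_trans _ _ (\sum_(k | lnorm2 R (boxpt k) <= N%:R ^+ 2 :> R)
    (2 * D)^-1 * \sum_(j < J | box j k) x ^+ j)); last first.
  apply: ler_sum => k _; rewrite ler_pdivrMl ?mulr_gt0// -mulrA.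
  by rewrite (le_trans (term k))// mulrA.
rewrite -mulr_sumr mulrC ler_wpM2l ?invr_ge0 ?mulr_ge0 ?(ltW D0)//.
have bb (j : 'I_J) k : box j k -> lnorm2 R (boxpt k) <= N%:R ^+ 2 :> R.
  by apply: box_sub_ball => //; rewrite leq_exp2l// ltnW.
rewrite (exchange_big_dep predT)//=.
rewrite -[leLHS]mulr1 mulr_natl -[X in _ *+ X](card_ord J) -sumr_const.
apply: ler_sum => j _.
rewrite (eq_bigl (mem (ffun_on (low_freq N (2 ^ j))))); last first.
  by move=> k /=; rewrite andb_idl// => /bb.
rewrite sumr_const card_ffun_on card_ord -mulr_natr natrX /x -exprM mulnC exprM -exprMn.
rewrite exprn_ege1// exprVn mulrC ler_pdivlMr ?exprn_gt0// mul1r -natrX ler_nat.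
apply: card_low_freq_ge; rewrite /N.
by rewrite -[X in (X <= _)%N]mul1n leq_mul// leq_exp2l// ltnW.
Qed.

Lemma sigmaN_le d N : sigmaN R d N <= (N.*2.+1)%:R ^+ d.
Proof.
rewrite /sigmaN /sum_ball big_mkcond/=.
apply: (@le_trans _ _ (\sum_(k : {ffun 'I_d -> 'I_(N.*2.+1)}) 1)).
  apply: ler_sum => k _; case: ifP => // _.
  by rewrite invf_le1 ?exprn_gt0 ?jbr_gt0// exprn_ege1// jbr_ge1.
by rewrite sumr_const cardT -cardE card_ffun !card_ord natrX.
Qed.

End Variance.

Section SmallBall.
Context {R : realType}.

Lemma normal_prob_ball_ge (a delta : R) : 0 < delta <= 1 ->
  ((delta * (normal_peak 1 * expR (- 1)) * expR (- a ^+ 2))%:E <=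
   normal_prob 0 1 `[(a - delta)%R, (a + delta)%R]%classic)%E.
Proof.
move=> /andP[d0 d1]; rewrite /normal_prob.
set c := normal_peak 1 * expR (-1) * expR (- a ^+ 2).
have pk0 : 0 <= normal_peak 1 :> R by rewrite invr_ge0 sqrtr_ge0.
have c0 : 0 <= c by rewrite !mulr_ge0// ?expR_ge0.
apply: (@le_trans _ _ (\int[lebesgue_measure]_(x in `[(a - delta)%R, (a + delta)%R]) (cst c%:E) x)%E).
  rewrite integral_cst//= lebesgue_measure_itv/= lte_fin.
  have -> : a - delta < a + delta by lra.
  rewrite -EFinB -EFinM lee_fin /c; move: c0; rewrite -/c.
  by rewrite -mulrA -/c; nra.
apply: ge0_le_integral_any => x /=; rewrite lee_fin// in_itv/= => /andP[xl xr].
rewrite normal_pdfE ?oner_neq0// /c -mulrA ler_wpM2l// /normal_fun -expRD ler_expR.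
have xa : (x - a) ^+ 2 <= 1 by nra.
have : 0 <= (x - a *+ 2) ^+ 2 by exact: sqr_ge0.
rewrite subr0 expr1n; lra.
Qed.

Lemma prode_ge (I : Type) (r : seq I) (F : I -> \bar R) (q : I -> R) :
  (forall i, 0 <= q i) -> (forall i, ((q i)%:E <= F i)%E) ->
  ((\prod_(i <- r) q i)%:E <= \prod_(i <- r) F i)%E.
Proof.
move=> q0 qF; elim: r => [|i r IH]; first by rewrite !big_nil.
by rewrite !big_cons EFinM lee_pmul// lee_fin ?prodr_ge0.
Qed.

Lemma boxpt_inj d N : injective (@boxpt d N).
Proof.
move=> k l /ffunP kl; apply/ffunP => i; have := kl i; rewrite !ffunE => h.
by apply/val_inj => /=; lia.
Qed.

Variables (dT : measure_display) (T : measurableType dT) (P : probability T R).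
Variables (d : nat) (X : bool * lattice d -> T -> R).
Hypothesis mX : forall i, measurable_fun setT (X i).
Hypothesis indX : mutually_independent P X.
Hypothesis nX : forall i (B : set R), measurable B ->
  P (X i @^-1` B) = normal_prob 0 1 B.

Lemma small_ball N (a : bool * lattice d -> R) (delta L : R) : 0 < delta <= 1 ->
  expR (- L) <= delta * (normal_peak 1 * expR (- 1)) ->
  exists A : set T, measurable A /\
    (forall w, A w -> forall b (k : {ffun 'I_d -> 'I_(N.*2.+1)}),
      `|X (b, boxpt k) w - a (b, boxpt k)| <= delta) /\
    ((expR (- \sum_(p : bool * {ffun 'I_d -> 'I_(N.*2.+1)})
        (L + a (p.1, boxpt p.2) ^+ 2)))%:E <= P A)%E.
Proof.
move=> d01 dL.
pose idx (p : bool * {ffun 'I_d -> 'I_(N.*2.+1)}) := (p.1, boxpt p.2).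
pose S := [seq idx p | p <- enum {: bool * {ffun 'I_d -> 'I_(N.*2.+1)}}].
have uS : uniq S.
  rewrite map_inj_uniq ?enum_uniq// => -[b k] [b' k'] [-> /boxpt_inj ->//].
pose B i := `[a i - delta, a i + delta]%classic.
have mB i : measurable (B i) by exact: measurable_itv.
exists (\bigcap_(i in [set` S]) (X i @^-1` B i)); split; [|split].
- apply: fin_bigcap_measurable => // i _.
  by rewrite -[_ @^-1` _]setTI; exact: mX.
- move=> w /= Aw b k; have /Aw : [set` S] (b, boxpt k).
    by apply/mapP; exists (b, k) => //; rewrite mem_enum.
  by rewrite /B/= in_itv/= => /andP[lo hi]; rewrite ler_norml; apply/andP; split; lra.
- rewrite indX// -sumrN expR_sum.
  apply: (@le_trans _ _ (\prod_(i <- S) expR (- (L + a i ^+ 2)))%:E).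
    by rewrite big_map big_enum.
  apply: prode_ge => i; first exact: expR_ge0.
  rewrite nX//; apply: le_trans (normal_prob_ball_ge _ d01).
  by rewrite lee_fin opprD expRD ler_wpM2r// expR_ge0.
Qed.

End SmallBall.

Section WickNear.
Context {R : realType}.

Lemma sub_sqr_le (a b F e : R) : `|b| <= F -> `|a - b| <= e ->
  `|a ^+ 2 - b ^+ 2| <= e * (2 * F + e).
Proof.
move=> bF ab; rewrite subr_sqr normrM ler_pM//.
rewrite (_ : a + b = 2 * b + (a - b)); last by ring.
rewrite (le_trans (ler_normD _ _))// lerD// normrM ger0_norm// ler_wpM2l//.
Qed.

Lemma quartic_near (a b e : R) : `|a - b| <= e -> e <= 1 ->
  b ^+ 4 / 8 - 1 <= a ^+ 4.
Proof.
move=> ab e1; have {ab e1} : (a - b) ^+ 2 <= 1.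
  by rewrite -real_normK ?num_real// expr_le1// (le_trans ab).
move=> h.
have b2 : b ^+ 2 <= 2 * a ^+ 2 + 2.
  by have := sqr_ge0 (2 * a - b); nra.
have : b ^+ 4 <= (2 * a ^+ 2 + 2) ^+ 2.
  by rewrite (exprM b 2 2) lerXn2r ?nnegrE ?sqr_ge0// (le_trans (sqr_ge0 b)).
have := sqr_ge0 (a ^+ 2 - 1); rewrite (exprM a 2 2); nra.
Qed.

Lemma wick_near d (u f : (nat -> R) -> R) (s K F e : R) :
  tlip d u -> tlip d f -> (forall x, `|f x| <= F) ->
  (forall x, `|u x - f x| <= e) -> e <= 1 -> e * (2 * F + e) <= K ->
  torus_int d (fun x => f x ^+ 2) = s -> 0 <= s ->
  `|torus_int d (fun x => hermite2 (u x) s)| <= K /\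
  torus_int d (fun x => f x ^+ 4) / 8 - 1 - 6 * s * (s + K) + 3 * s ^+ 2 <=
  torus_int d (fun x => hermite4 (u x) s).
Proof.
move=> lu lf fF ue e1 eK fs s0.
have sq x : `|u x ^+ 2 - f x ^+ 2| <= K.
  by rewrite (le_trans (sub_sqr_le (fF x) (ue x))).
have lf2 := tlipX 2 lf; have lf4 := tlipX 4 lf.
have lu2 := tlipX 2 lu; have lu4 := tlipX 4 lu.
have lc c := @tlip_cst R d c.
have lh2 : tlip d (fun x => hermite2 (u x) s) by apply: tlipD => //; exact: lc.
split.
  have aff c : torus_int d (fun x => 1 * f x ^+ 2 + c) = s + c.
    by rewrite torus_intMD ?torus_int_cst ?fs ?mul1r.
  have laff c : tlip d (fun x => 1 * f x ^+ 2 + c).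
    by apply: tlipD => //; apply: tlipM.
  rewrite ler_norml; apply/andP; split.
    rewrite (_ : - K = s + (- s - K)); last by ring.
    rewrite -aff; apply: le_torus_int => // x.
    have := sq x; rewrite /hermite2 ler_norml => /andP[? ?]; lra.
  rewrite (_ : K = s + (- s + K)); last by ring.
  rewrite -aff; apply: le_torus_int => // x.
  have := sq x; rewrite /hermite2 ler_norml => /andP[? ?]; lra.
pose c := - 1 - 6 * s * K + 3 * s ^+ 2.
have -> : torus_int d (fun x => f x ^+ 4) / 8 - 1 - 6 * s * (s + K) + 3 * s ^+ 2 =
  torus_int d (fun x => 8^-1 * f x ^+ 4 + (- 6 * s * f x ^+ 2 + c)).
  rewrite torus_intMD//; last by apply: tlipD => //; apply: tlipM.
  by rewrite torus_intMD// fs torus_int_cst /c; lra.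
apply: le_torus_int.
- by apply: tlipD; [apply: tlipM|apply: tlipD => //; apply: tlipM].
- apply: tlipD => //; apply: tlipD => //.
  by apply: (@tlip_ext _ _ (fun x => - (6 * s) * u x ^+ 2)) => [x|];
    [rewrite mulNr|apply: tlipM].
- move=> x; rewrite /hermite4 /c.
  have q4 := quartic_near (ue x) e1.
  have : 6 * s * u x ^+ 2 <= 6 * s * (f x ^+ 2 + K).
    rewrite ler_wpM2l ?mulr_ge0//.
    by have := sq x; rewrite ler_norml => /andP[? ?]; lra.
  lra.
Qed.

End WickNear.

Section Profile.
Context {R : realType}.
Variables d M : nat.
Hypotheses (d0 : (0 < d)%N) (M0 : (0 < M)%N).
Local Notation N := (d * M)%N.
Local Notation s := (sigmaN R d N).
Local Notation q := (#|low_freq N M|%:R : R).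
Local Notation V := ((N.*2.+1)%:R ^+ d : R).
Hypothesis s_gt0 : 0 < s.

(* [amplitude] is tuned so that the profile has mean square exactly [s]: this is
   what makes its Wick-ordered mass vanish. *)
Definition amplitude : R := Num.sqrt (s / q ^+ d).

Definition profile (x : nat -> R) : R :=
  amplitude * \prod_(i < d) dirichlet N M (x i).

Definition profile_coef (p : bool * lattice d) : R :=
  if ~~ p.1 && [forall i, `|p.2 i| <= M%:Z] then
    amplitude * jbr R p.2 `^ (d%:R / 2) else 0.

Lemma M_le_N : (M <= N)%N.
Proof. by rewrite -[X in (X <= _)%N]mul1n leq_mul. Qed.

Lemma q_ge : M%:R <= q.
Proof. by rewrite ler_nat card_low_freq_ge// M_le_N. Qed.

Lemma q_gt0 : 0 < q.
Proof. by apply: lt_le_trans q_ge; rewrite ltr0n. Qed.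

Lemma q_le : q <= (N.*2.+1)%:R.
Proof. by rewrite ler_nat card_low_freq_le. Qed.

Lemma amplitude_sqr : amplitude ^+ 2 = s / q ^+ d.
Proof. by rewrite sqr_sqrtr// divr_ge0 ?exprn_ge0 ?(ltW s_gt0). Qed.

Lemma tlip_dirichlet_coord n (i : 'I_d) :
  tlip d (fun x : nat -> R => dirichlet N M (x i) ^+ n).
Proof.
have [C [hb hl]] := @tlip_dirichletX R N M n.
apply: (@tlip_coord _ _ (fun t => dirichlet N M t ^+ n) C) => // [t|t t'].
  exact: (hb (fun=> t)).
by have := hl (fun=> t) (fun=> t'); rewrite big_ord1.
Qed.

Lemma tlip_profile : tlip d profile.
Proof.
apply: tlipM; first exact: tlip_cst.
by apply: tlip_prod => i _; exact: (@tlip_dirichlet_coord 1).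
Qed.

Lemma torus_int_profileX n : torus_int d (fun x => profile x ^+ n) =
  amplitude ^+ n * (torus_int 1 (fun x => dirichlet N M (x 0%N) ^+ n)) ^+ d.
Proof.
transitivity (torus_int d (fun x =>
    amplitude ^+ n * \prod_(i < d) dirichlet N M (x i) ^+ n)).
  by apply: torus_int_ext => x; rewrite /profile exprMn prodrXl.
rewrite torus_intZ; last first.
  by apply: tlip_prod => i _; exact: tlip_dirichlet_coord.
have [C [hb hl]] := @tlip_dirichletX R N M n.
rewrite (@torus_int_prod _ d (fun t => dirichlet N M t ^+ n) C)//.
- by move=> t; exact: (hb (fun=> t)).
- by move=> t t'; have := hl (fun=> t) (fun=> t'); rewrite big_ord1.
Qed.

Lemma profile_mass : torus_int d (fun x => profile x ^+ 2) = s.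
Proof.
rewrite torus_int_profileX dirichlet_mass amplitude_sqr divfK//.
by rewrite expf_neq0// gt_eqF// q_gt0.
Qed.

Lemma profile_quartic :
  s ^+ 2 * (M%:R / (32 * pi)) ^+ d <= torus_int d (fun x => profile x ^+ 4).
Proof.
have q0 := q_gt0; have pi0 := @pi_gt0 R.
have MR : 0 < M%:R :> R by rewrite ltr0n.
rewrite torus_int_profileX (exprM amplitude 2 2) amplitude_sqr (expr_div_n s) -[leRHS]mulrA.
rewrite ler_wpM2l ?sqr_ge0//.
have -> : ((q ^+ d) ^+ 2)^-1 = (q ^+ 2)^-1 ^+ d by rewrite exprVn -!exprM [(d * 2)%N]mulnC.
rewrite -exprMn.
apply: lerXn2r; rewrite ?nnegrE.
- by rewrite divr_ge0// mulr_ge0// ltW.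
- rewrite mulr_ge0 ?invr_ge0 ?sqr_ge0//.
  apply: le_trans (@dirichlet_quartic R N M M0).
  by rewrite divr_ge0 ?mulr_ge0 ?exprn_ge0 ?divr_ge0 ?invr_ge0 ?(ltW pi2_gt0).
apply: (@le_trans _ _ ((q ^+ 2)^-1 * ((pi *+ 2)^-1 * (q / 2) ^+ 4 / M%:R))).
  have gen (p c e : R) : 0 < p -> 0 < c -> 0 < e ->
      (c ^+ 2)^-1 * ((p *+ 2)^-1 * (c / 2) ^+ 4 / e) - e / (32 * p) =
      (c ^+ 2 - e ^+ 2) / (32 * p * e).
    by move=> p0 c0 e0; field; rewrite !gt_eqF.
  rewrite -subr_ge0 gen// divr_ge0 ?mulr_ge0 ?(ltW pi0) ?(ltW MR)//.
  by rewrite subr_ge0 lerXn2r ?nnegrE ?q_ge.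
by rewrite ler_wpM2l ?invr_ge0 ?sqr_ge0// dirichlet_quartic.
Qed.

Lemma norm_profile_le x : `|profile x| <= V.
Proof.
have q0 := q_gt0.
have a0 : 0 <= amplitude by exact: sqrtr_ge0.
rewrite normrM (ger0_norm a0) normr_prod.
have V0 : 0 <= V by rewrite exprn_ge0.
apply: (@le_trans _ _ (amplitude * q ^+ d)).
  rewrite ler_wpM2l//.
  have -> : q ^+ d = \prod_(i < d) q by rewrite prodr_const card_ord.
  by apply: ler_prod => i _; rewrite normr_ge0/= norm_dirichlet_le.
rewrite -ler_sqr ?nnegrE ?mulr_ge0 ?exprn_ge0//.
rewrite exprMn amplitude_sqr [X in _ * X]expr2 mulrA divfK; last first.
  by rewrite expf_neq0// gt_eqF.
rewrite [leRHS]expr2; apply: ler_pM; rewrite ?(ltW s_gt0) ?exprn_ge0 ?sigmaN_le//.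
by rewrite lerXn2r ?nnegrE ?q_le.
Qed.

Lemma low_freq_boxptE (k : {ffun 'I_d -> 'I_(N.*2.+1)}) :
  [forall i, `|boxpt k i| <= M%:Z] = (k \in ffun_on (low_freq N M)).
Proof.
apply: eq_forallb => i; rewrite ffunE inE/=; have := ltn_ord (k i); lia.
Qed.

Lemma profileE x : profile x = sum_ball N
  (fun n => jbr R n `^ (- (d%:R / 2)) * (profile_coef (false, n) * cos (ldot n x))).
Proof.
rewrite /profile prod_dirichlet mulr_sumr /sum_ball.
rewrite [LHS]big_mkcond [RHS]big_mkcond/=; apply: eq_bigr => k _.
rewrite /profile_coef /= low_freq_boxptE.
case: ifPn => kS; last by rewrite mul0r mulr0 if_same.
rewrite (box_sub_ball d0 erefl (leqnn M) kS) mulrA mulrCA powRN mulVf ?mulr1//.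
by rewrite gt_eqF// powR_gt0// jbr_gt0.
Qed.

Lemma profile_coef_neg b n : profile_coef (b, lneg n) = profile_coef (b, n).
Proof.
rewrite /profile_coef/=; congr (if _ && _ then _ * _ `^ _ else _).
  by apply: eq_forallb => i; rewrite ffunE normrN.
rewrite /jbr /lnorm2; congr (Num.sqrt (1 + _)); apply: eq_bigr => i _.
by rewrite ffunE intrN sqrrN.
Qed.

Lemma lneg_boxpt (k : {ffun 'I_d -> 'I_(N.*2.+1)}) :
  lneg (boxpt k) = boxpt [ffun i => rev_ord (k i)].
Proof. by apply/ffunP => i; rewrite !ffunE rev_ord_freq. Qed.

Lemma sum_profile_coef_sqr :
  \sum_(k : {ffun 'I_d -> 'I_(N.*2.+1)}) profile_coef (false, boxpt k) ^+ 2 <= s * V.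
Proof.
have q0 := q_gt0; have qd : q ^+ d != 0 by rewrite expf_neq0// gt_eqF.
apply: (@le_trans _ _ (\sum_(k : {ffun 'I_d -> 'I_(N.*2.+1)} |
    k \in ffun_on (low_freq N M)) amplitude ^+ 2 * V)); last first.
  by rewrite sumr_const card_ffun_on card_ord -[leLHS]mulr_natr natrX mulrAC amplitude_sqr divfK.
rewrite [leRHS]big_mkcond; apply: ler_sum => k _.
rewrite /profile_coef /= low_freq_boxptE; case: ifPn => kS; last by rewrite expr0n.
rewrite exprMn ler_wpM2l ?sqr_ge0//.
have -> : (jbr R (boxpt k) `^ (d%:R / 2)) ^+ 2 = jbr R (boxpt k) ^+ d.
  rewrite -!powR_mulrn ?sqrtr_ge0 ?powR_ge0// -powRrM; congr (_ `^ _); lra.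
rewrite lerXn2r ?nnegrE ?sqrtr_ge0// (le_trans (jbr_boxpt_le M0 kS))//.
by rewrite -natrM ler_nat; move: d0 M0; nia.
Qed.

Section Field.
Variables (T : Type) (X : bool * lattice d -> T -> R) (w : T).

Lemma tlip_uN n : tlip d (uN X n w).
Proof.
apply: tlip_sum => k _; apply: tlipM; first exact: tlip_cst.
apply: tlipD.
  apply: tlipM; first exact: tlip_cst.
  by apply: tlip_comp_ldot => *; [exact: cos_max|exact: cos_lipschitz].
pose sn := (fun x : nat -> R => sin (ldot (boxpt k) x)).
apply: (@tlip_ext _ _ (fun x => - gIm X (boxpt k) w * sn x)).
  by move=> x; rewrite mulNr.
apply: tlipM; first exact: tlip_cst.
by apply: tlip_comp_ldot => *; [exact: sin_max|exact: sin_lipschitz].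
Qed.

Variable delta : R.
Hypothesis Xnear : forall b (k : {ffun 'I_d -> 'I_(N.*2.+1)}),
  `|X (b, boxpt k) w - profile_coef (b, boxpt k)| <= delta.

Lemma uN_near_profile x : `|uN X N w x - profile x| <= V * (2 * delta).
Proof.
rewrite profileE /uN /sum_ball -sumrB (le_trans (ler_norm_sum _ _ _))//.
rewrite big_mkcond/=.
have dl0 : 0 <= delta.
  by apply: le_trans (Xnear true [ffun=> ord0]).
apply: (@le_trans _ _ (\sum_(k : {ffun 'I_d -> 'I_(N.*2.+1)}) (2 * delta)));
  last first.
  by rewrite sumr_const cardT -cardE card_ffun !card_ord -[leLHS]mulr_natl natrX.
apply: ler_sum => k _; case: ifP => [_|_]; last by rewrite mulr_ge0.
rewrite -mulrBr normrM ger0_norm ?powR_ge0//.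
rewrite (@le_trans _ _ (1 * (2 * delta)))//; last by rewrite mul1r.
rewrite ler_pM ?powR_ge0//.
  rewrite powRN invf_le1 ?powR_gt0 ?jbr_gt0//.
  have := @ler_powR R _ (jbr_ge1 (boxpt k)) 0 (d%:R / 2).
  by rewrite powRr0; apply; rewrite divr_ge0.
have near b : `|X (b, boxpt k) w - profile_coef (b, boxpt k)| <= delta by [].
have nearN b : `|X (b, lneg (boxpt k)) w - profile_coef (b, boxpt k)| <= delta.
  by rewrite -profile_coef_neg lneg_boxpt.
have Re : `|gRe X (boxpt k) w - profile_coef (false, boxpt k)| <= delta.
  have := near false; have := nearN false; rewrite /gRe !ler_norml.
  by move=> /andP[? ?] /andP[? ?]; apply/andP; split; lra.
have Im : `|gIm X (boxpt k) w| <= delta.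
  have := near true; have := nearN true; rewrite /gIm /profile_coef/= !ler_norml.
  by move=> /andP[? ?] /andP[? ?]; apply/andP; split; lra.
rewrite (_ : _ - _ = (gRe X (boxpt k) w - profile_coef (false, boxpt k)) *
  cos (ldot (boxpt k) x) - gIm X (boxpt k) w * sin (ldot (boxpt k) x)); last by ring.
rewrite (le_trans (ler_normB _ _))// normrM (normrM (gIm _ _ _)) (_ : 2 * delta = delta * 1 + delta * 1).
  by rewrite lerD// ler_pM// ?cos_max ?sin_max.
by ring.
Qed.

End Field.

Section LowerBound.
Variables (dT : measure_display) (T : measurableType dT) (P : probability T R).
Variables (X : bool * lattice d -> T -> R) (sigma K L : R).
Hypothesis mX : forall i, measurable_fun setT (X i).
Hypothesis indX : mutually_independent P X.
Hypothesis nX : forall i (B : set R), measurable B ->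
  P (X i @^-1` B) = normal_prob 0 1 B.
Hypotheses (sigma0 : 0 < sigma) (K0 : 0 < K).

Lemma cutoff_partition_ge :
  expR (- L) <= Num.min 1 K / (6 * V ^+ 2) * (normal_peak 1 * expR (- 1)) ->
  ((expR (sigma / 4 * (s ^+ 2 * (M%:R / (32 * pi)) ^+ d / 8 - 1 -
      6 * s * (s + K) + 3 * s ^+ 2) - V * (2 * L + s)))%:E <=
   \int[P]_w ((\1_[set w' | `|wick2_mass X N w'| <= K] w) *
     expR (RN X sigma N w))%:E)%E.
Proof.
set kap := Num.min 1 K => hL.
have kap0 : 0 < kap by rewrite lt_min ltr01.
have kap1 : kap <= 1 by rewrite ge_min lexx.
have kapK : kap <= K by rewrite ge_min lexx orbT.
have V1 : 1 <= V by rewrite exprn_ege1// ler1n.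
pose eps := kap / (2 * V + 1); pose delta := eps / (2 * V).
have eps0 : 0 < eps by rewrite divr_gt0//; lra.
have epsV : eps * (2 * V + 1) = kap by rewrite /eps divfK// gt_eqF//; lra.
have eps1 : eps <= 1 by nra.
have dl0 : 0 < delta by rewrite divr_gt0//; lra.
have dlV : V * (2 * delta) = eps by rewrite /delta; field; rewrite gt_eqF//; lra.
have dl1 : delta <= 1 by nra.
have dlL : expR (- L) <= delta * (normal_peak 1 * expR (- 1)).
  apply: le_trans hL _; rewrite ler_wpM2r//.
    by rewrite mulr_ge0 ?expR_ge0// invr_ge0 sqrtr_ge0.
  rewrite ler_pdivrMr; last by rewrite mulr_gt0// exprn_gt0//; lra.
  have : 0 <= delta * V * (V - 1) by rewrite !mulr_ge0 ?(ltW dl0)//; lra.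
  by rewrite -epsV -dlV; lra.
have [A [mA [nearA PA]]] :=
  small_ball mX indX nX N profile_coef (introT andP (conj dl0 dl1)) dlL.
set rho := sigma / 4 * _.
have onA w : A w -> `|wick2_mass X N w| <= K /\ rho <= RN X sigma N w.
  move=> /nearA near.
  have [||w2 w4] := wick_near (tlip_uN X w N) tlip_profile norm_profile_le
    (fun x => uN_near_profile near x) _ _ profile_mass (ltW s_gt0) (K := K).
  - by rewrite dlV.
  - rewrite dlV (le_trans _ kapK)// -[leRHS]epsV ler_wpM2l ?(ltW eps0)//; lra.
  split=> //; rewrite /RN /rho.
  apply: ler_wpM2l; first by rewrite mulr_ge0 ?invr_ge0// ltW.
  by apply: le_trans w4; have := profile_quartic; lra.
apply: (@le_trans _ _ (\int[P]_w ((expR rho)%:E * (\1_A w)%:E))%E); last first.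
  apply: ge0_le_integral_any => w _; rewrite -EFinM lee_fin.
    by rewrite mulr_ge0 ?expR_ge0// indicE.
  rewrite !indicE; case: (boolP (w \in A)) => [/set_mem/onA[wK wR]|_].
    by rewrite mem_set//= mulr1 mul1r ler_expR.
  by rewrite mulr0 mulr_ge0// expR_ge0.
rewrite ge0_integralZl//; last 1 first.
- by apply/measurable_EFinP; exact: measurable_indic.
rewrite integral_indic// setIT expRD EFinM.
apply: lee_pmul; rewrite ?lee_fin ?expR_ge0//.
apply: le_trans PA; rewrite lee_fin ler_expR lerN2 big_split/=.
rewrite sumr_const cardT -cardE card_prod card_bool card_ffun !card_ord.
rewrite mulrDr lerD//; first by rewrite -[leLHS]mulr_natl natrM natrX mulrA (mulrC V).
rewrite -(pair_bigA _ (fun b k => profile_coef (b, boxpt k) ^+ 2))/= big_bool/=.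
rewrite big1 ?add0r; first by rewrite (le_trans sum_profile_coef_sqr)// mulrC.
by move=> k _; rewrite /profile_coef/= expr0n.
Qed.

End LowerBound.
End Profile.

Section Asymptotics.
Context {R : realType}.

Lemma quartic_beats_cost (sigma K c D a b : R) :
  0 < sigma -> 0 < K -> 0 < c -> 0 < D -> 0 <= a -> 0 <= b ->
  exists s0 y0 : R, forall s y V l, s0 <= s -> y0 <= y -> 0 <= V -> V <= D * y ->
    l <= a + b * s ->
    y <= sigma / 4 * (s ^+ 2 * (c * y) / 8 - 1 - 6 * s * (s + K) + 3 * s ^+ 2) -
         V * l.
Proof.
move=> sg0 K0 c0 D0 a0 b0.
pose g := sigma * c / 64; have g0 : 0 < g by rewrite !mulr_gt0.
pose h := D * a + D * b + 1.
have h0 : 0 < h by rewrite ltr_wpDl// addr_ge0// mulr_ge0// ltW.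
exists (1 + K + h / g), (160 / c) => s y V l ss yy V0 VD ll.
have hg : 0 < h / g by rewrite divr_gt0.
have s1 : 1 <= s by lra.
have sK : K <= s by lra.
have gs : h <= g * s by rewrite -ler_pdivrMl//; rewrite mulrC; lra.
have cy : 10 <= c * y / 16.
  by move: yy; rewrite ler_pdivrMr// mulrC; lra.
have y0 : 0 < y by rewrite (lt_le_trans _ yy)// divr_gt0.
have cost : V * l <= D * y * (a + b * s).
  rewrite (@le_trans _ _ (V * (a + b * s)))//; first by rewrite ler_wpM2l.
  by rewrite ler_wpM2r// addr_ge0// mulr_ge0//; lra.
have low : 1 + 6 * s * K + 3 * s ^+ 2 <= 10 * s ^+ 2 by nra.
have low2 : 10 * s ^+ 2 <= c * y / 16 * s ^+ 2 by rewrite ler_wpM2r// sqr_ge0.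
have gain : g * y * s ^+ 2 <=
    sigma / 4 * (s ^+ 2 * (c * y) / 8 - 1 - 6 * s * (s + K) + 3 * s ^+ 2).
  rewrite (_ : g * y * s ^+ 2 = sigma / 4 * (c * y / 16 * s ^+ 2)); last first.
    by rewrite /g; field.
  by apply: ler_wpM2l; [rewrite divr_ge0// ltW|lra].
have net : y * s * h <= g * y * s ^+ 2.
  rewrite (_ : g * y * s ^+ 2 = y * s * (g * s)); last by ring.
  by rewrite ler_wpM2l// mulr_ge0//; lra.
have as1 : D * a * y <= D * a * y * s.
  by rewrite ler_peMr// !mulr_ge0// ltW.
have ys : y <= y * s by rewrite ler_peMr// ltW.
move: net; rewrite /h; lra.
Qed.

Lemma exp2_le_expR J : 2 ^+ J <= expR J%:R :> R.
Proof.
rewrite -[J%:R]mulr1 expRM_natl lerXn2r ?nnegrE ?expR_ge0//.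
by have := expR_ge1Dx (1 : R); lra.
Qed.

Lemma box_side_le d J : (0 < d)%N ->
  ((d * 2 ^ J).*2.+1)%:R <= (3 * d)%:R * 2 ^+ J :> R.
Proof.
move=> d0; rewrite -natrX -natrM ler_nat.
have : (0 < 2 ^ J)%N by rewrite expn_gt0.
by nia.
Qed.

Lemma box_side_le_expR d J : (0 < d)%N ->
  ((d * 2 ^ J).*2.+1)%:R <= expR ((3 * d)%:R + J%:R) :> R.
Proof.
move=> d0; apply: le_trans (box_side_le J d0) _; rewrite expRD.
apply: ler_pM; rewrite ?exprn_ge0 ?exp2_le_expR//.
by have := expR_ge1Dx ((3 * d)%:R : R); lra.
Qed.

End Asymptotics.

Theorem theorem1p3 (R : realType) (dT : measure_display) (T : measurableType dT)
    (P : probability T R) (d : nat) (X : bool * lattice d -> T -> R)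
    (sigma K : R) :
  (1 <= d)%N -> 0 < sigma -> 0 < K ->
  (forall i, measurable_fun setT (X i)) ->
  mutually_independent P X ->
  (forall i (B : set R), measurable B -> P (X i @^-1` B) = normal_prob 0 1 B) ->
  let E1 := fun N : nat => (\int[P]_w (expR (RN X sigma N w))%:E)%E in
  let E2 := fun N : nat =>
    (\int[P]_w ((\1_[set w' | wick2_mass X N w' <= K] w) * expR (RN X sigma N w))%:E)%E in
  let E3 := fun N : nat =>
    (\int[P]_w ((\1_[set w' | `|wick2_mass X N w'| <= K] w) * expR (RN X sigma N w))%:E)%E in
  (ereal_sup (range E2) <= ereal_sup (range E1))%E /\
  (ereal_sup (range E3) <= ereal_sup (range E2))%E /\
  ereal_sup (range E3) = +oo%E.
Proof.
move=> d0 sg0 K0 mX indX nX E1 E2 E3.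
have mono (F G : nat -> \bar R) : (forall N, F N <= G N)%E ->
    (ereal_sup (range F) <= ereal_sup (range G))%E.
  move=> FG; apply: ge_ereal_sup => _ [N _ <-]; apply: (le_trans (FG N)).
  by apply: ereal_sup_ubound; exists N.
split; [|split].
- apply: mono => N; apply: ge0_le_integral_any => w _; rewrite lee_fin.
    by rewrite mulr_ge0 ?expR_ge0// indicE.
  by rewrite ler_piMl ?expR_ge0// indicE lern1 leq_b1.
- apply: mono => N; apply: ge0_le_integral_any => w _; rewrite lee_fin.
    by rewrite mulr_ge0 ?expR_ge0// indicE.
  rewrite ler_wpM2r ?expR_ge0// !indicE ler_nat.
  case: (boolP (w \in [set w' | `|wick2_mass X N w'| <= K])) => // /set_mem/= wK.
  by rewrite mem_set//= (le_trans (ler_norm _)).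
pose c0 := normal_peak 1 * expR (- 1) : R.
pose C1 := - ln (Num.min 1 K / 6 * c0).
have c0_gt0 : 0 < c0.
  by rewrite mulr_gt0 ?expR_gt0// invr_gt0 sqrtr_gt0 expr1n mul1r pi2_gt0.
have kc0 : 0 < Num.min 1 K / 6 * c0.
  by rewrite mulr_gt0// divr_gt0// lt_min ltr01.
pose B : R := 2 * d.+1%:R ^+ d.
have B0 : 0 < B by rewrite mulr_gt0// exprn_gt0.
pose c : R := (32 * pi)^-1 ^+ d.
have c_gt0 : 0 < c by rewrite exprn_gt0// invr_gt0 mulr_gt0// pi_gt0.
pose D : R := (3 * d)%:R ^+ d.
have D0 : 0 < D by rewrite exprn_gt0// ltr0n muln_gt0.
pose a : R := `|2 * C1| + 12 * d%:R ^+ 2.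
pose b : R := 4 * d%:R * B + 1.
have a0 : 0 <= a by rewrite addr_ge0// mulr_ge0// sqr_ge0.
have b0 : 0 <= b by rewrite addr_ge0// !mulr_ge0// ltW.
have [s0 [y0 win]] := quartic_beats_cost sg0 K0 c_gt0 D0 a0 b0.
apply: eq_infty => r.
pose J := (Num.truncn (Num.max (Num.max r (B * s0)) (Num.max y0 1))).+1.
have : Num.max (Num.max r (B * s0)) (Num.max y0 1) <= J%:R by rewrite ltW// truncnS_gt.
rewrite !ge_max => /andP[/andP[rJ sJ] /andP[yJ J1]].
pose N := (d * 2 ^ J)%N; pose s := sigmaN R d N.
pose V : R := (N.*2.+1)%:R ^+ d; pose y : R := (2 ^ J)%:R ^+ d.
have JB : J%:R / B <= s by exact: sigmaN_ge_log.
have ss0 : s0 <= s by apply: le_trans JB; rewrite ler_pdivlMr// mulrC.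
have s_gt0 : 0 < s by apply: lt_le_trans JB; rewrite divr_gt0// (lt_le_trans ltr01).
have Jy : J%:R <= y.
  rewrite /y -natrX ler_nat (leq_trans (ltnW (ltn_expl J (ltnSn 1))))//.
  by rewrite -[X in (X <= _)%N]expn1 leq_pexp2l// expn_gt0.
have VD : V <= D * y.
  rewrite /D /y -exprMn lerXn2r ?nnegrE// ?mulr_ge0// natrX.
  exact: box_side_le.
pose L := C1 + (2 * d)%:R * ((3 * d)%:R + J%:R).
have hL : expR (- L) <= Num.min 1 K / (6 * V ^+ 2) * (normal_peak 1 * expR (- 1)).
  rewrite opprD expRD opprK lnK ?posrE// -/c0.
  rewrite (_ : Num.min 1 K / (6 * V ^+ 2) * c0 = Num.min 1 K / 6 * c0 * (V ^+ 2)^-1);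
    last by rewrite invfM; ring.
  rewrite ler_wpM2l ?(ltW kc0)// expRN lef_pV2 ?posrE ?expR_gt0 ?exprn_gt0//.
  rewrite expRM_natl /V -exprM mulnC lerXn2r ?nnegrE ?expR_ge0//.
  exact: box_side_le_expR.
have low := cutoff_partition_ge d0 (expn_gt0 2 J) s_gt0 mX indX nX sg0 K0 hL.
apply: (@le_trans _ _ (E3 N)); last by apply: ereal_sup_ubound; exists N.
apply: le_trans low; rewrite lee_fin (le_trans rJ)// (le_trans Jy)//.
set Phi := (X in expR X).
apply: (@le_trans _ _ Phi); last by have := expR_ge1Dx Phi; lra.
rewrite /Phi -/N -/s -/V.
rewrite (_ : ((2 ^ J)%:R / (32 * pi)) ^+ d = c * y); last by rewrite exprMn mulrC.
apply: win => //; [exact: le_trans yJ Jy|exact: exprn_ge0|].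
have JBs : J%:R <= B * s by rewrite mulrC -ler_pdivrMr.
have dJ : 4 * d%:R * J%:R <= 4 * d%:R * (B * s) by rewrite ler_wpM2l ?mulr_ge0.
have := ler_norm (2 * C1); rewrite /L /a /b !natrM; lra.
Qed.
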